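(* Let $R$ be a ring (with identity, not necessarily commutative) and let $X$ be a locally finite partially ordered set such that $\mathrm{Min}(X)$ is a maximal antichain of $X$ and $\kappa(x)$ is finite for every $x\in \mathrm{Min}(X)$. Then $$\mathrm{Sing}_l(I(X,R)) = I(X,\mathrm{Sing}_l(R)).$$
   Context: A partially ordered set $X$ is locally finite if every interval $[x,y]=\{z\in X: x\le z\le y\}$ is finite. $\mathrm{Min}(X)$ is the set of minimal elements of $X$ (possibly empty). For $x\in X$, $\kappa(x)=|\{y\in X: x\le y\}|$. An antichain is a set of pairwise incomparable elements; a maximal antichain is one that is maximal under inclusion among antichains of $X$. The incidence ring $I(X,R)$ is the set of functions $f:X\times X\to R$ with $f(x,y)=0$ unless $x\le y$, with pointwise addition and product $(fg)(x,y)=\sum_{x\le z\le y} f(x,z)g(z,y)$. For an ideal $J$ of $R$, $I(X,J)$ denotes the set of $f\in I(X,R)$ all of whose values lie in $J$. A left ideal of a ring is left essential if it intersects every nonzero left ideal nontrivially. For a ring $A$ and $a\in A$, $\mathrm{ann}_l(a)=\{b\in A: ba=0\}$, and the left singular ideal is $\mathrm{Sing}_l(A)=\{a\in A: \mathrm{ann}_l(a)\text{ is a left essential ideal of }A\}$ (a two-sided ideal). *)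

(* Defs.v *)
From HB Require Import structures.
From mathcomp Require Import all_boot all_order all_algebra finmap.
From mathcomp Require Import boolp classical_sets functions cardinality fsbigop.

Set Implicit Arguments.
Unset Strict Implicit.
Unset Printing Implicit Defensive.

Import Order.TTheory GRing.Theory.

Local Open Scope classical_set_scope.
Local Open Scope ring_scope.

(* A [pzRingType] has a 1 but may be the zero ring, as happens to the incidence
   ring over the empty order; all conventions below make sense in that case. *)
Section Rings.
Variable A : pzRingType.

Definition left_ideal (J : set A) : Prop :=
  [/\ J 0, (forall u v, J u -> J v -> J (u - v))
    & (forall a u, J u -> J (a * u))].

Definition left_essential (I : set A) : Prop :=
  left_ideal I /\
  forall J : set A, left_ideal J -> J <> [set 0] -> I `&` J <> [set 0].

Definition ann_l (a : A) : set A := [set b | b * a = 0].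

Definition Sing_l : set A := [set a | left_essential (ann_l a)].

End Rings.

Arguments Sing_l A : clear implicits.

Section Posets.
Context {d : Order.disp_t} (X : porderType d).

Definition Min : set X := [set x | forall y, (y <= x)%O -> y = x].

Definition antichain (C : set X) : Prop :=
  forall x y, C x -> C y -> x <> y -> (x >< y)%O.

Definition maximal_antichain (C : set X) : Prop :=
  antichain C /\ forall D : set X, antichain D -> C `<=` D -> D = C.

End Posets.

Arguments Min {d} X.

HB.mixin Record isLocallyFinite (d : Order.disp_t) X of Order.POrder d X := {
  finite_interval : forall x y : X, finite_set [set z : X | (x <= z <= y)%O]
}.

#[short(type="locFinPOrderType")]
HB.structure Definition LocFinPOrder (d : Order.disp_t) :=
  { X of Order.POrder d X & isLocallyFinite d X }.

Record incidence d (X : locFinPOrderType d) (R : pzRingType) := Incidence {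
  inc_fun :> X -> X -> R;
  inc_supp : forall x y, ~~ (x <= y)%O -> inc_fun x y = 0
}.

Section IncidenceRing.
Context {d : Order.disp_t} (X : locFinPOrderType d) (R : pzRingType).
Local Notation I := (incidence X R).

HB.instance Definition _ := gen_eqMixin I.
HB.instance Definition _ := gen_choiceMixin I.

Lemma incP (f g : I) : (forall x y, f x y = g x y) -> f = g.
Proof.
case: f g => [f f0] [g g0] /= fg.
have {}fg : f = g by apply/funext => x; apply/funext => y.
by rewrite fg in f0 *; congr Incidence; exact: Prop_irrelevance.
Qed.

Fact inc_zero_supp x y : ~~ (x <= y :> X)%O -> (0 : R) = 0.
Proof. by []. Qed.
Definition inc_zero : I := Incidence inc_zero_supp.

Fact inc_opp_supp (f : I) x y : ~~ (x <= y)%O -> - f x y = 0.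
Proof. by move=> /inc_supp ->; rewrite oppr0. Qed.
Definition inc_opp (f : I) : I := Incidence (inc_opp_supp f).

Fact inc_add_supp (f g : I) x y : ~~ (x <= y)%O -> f x y + g x y = 0.
Proof. by move=> xy; rewrite !inc_supp// addr0. Qed.
Definition inc_add (f g : I) : I := Incidence (inc_add_supp f g).

Fact inc_addA : associative inc_add.
Proof. by move=> f g h; apply: incP => x y /=; rewrite addrA. Qed.

Fact inc_addC : commutative inc_add.
Proof. by move=> f g; apply: incP => x y /=; rewrite addrC. Qed.

Fact inc_add0 : left_id inc_zero inc_add.
Proof. by move=> f; apply: incP => x y /=; rewrite add0r. Qed.

Fact inc_addN : left_inverse inc_zero inc_opp inc_add.
Proof. by move=> f; apply: incP => x y /=; rewrite addNr. Qed.

HB.instance Definition _ :=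
  GRing.isZmodule.Build I inc_addA inc_addC inc_add0 inc_addN.

Fact inc_one_supp x y : ~~ (x <= y :> X)%O -> (x == y)%:R = 0 :> R.
Proof. by case: eqVneq => // ->; rewrite lexx. Qed.
Definition inc_one : I := Incidence inc_one_supp.

Fact inc_mul_supp (f g : I) x y : ~~ (x <= y)%O ->
  \sum_(z \in [set z : X | (x <= z <= y)%O]) f x z * g z y = 0.
Proof.
move=> xy; apply: fsbig1 => z /= /andP[xz zy].
by rewrite (le_trans xz zy) in xy.
Qed.
Definition inc_mul (f g : I) : I := Incidence (inc_mul_supp f g).

Fact inc_mulA : associative inc_mul.
Proof.
move=> f g h; apply: incP => x y /=.
pose D : set X := [set z | (x <= z <= y)%O].
transitivity (\sum_(z \in D) \sum_(w \in D) f x z * g z w * h w y).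
  apply: eq_fsbigr => z; rewrite inE => /andP[xz zy].
  rewrite (fsbig_widen _ D); first last.
  - move=> w [/andP[xw wy] /= nzw]; rewrite /preimage/= inc_supp ?mul0r//.
    by apply/negP => zw; apply: nzw; rewrite zw.
  - by move=> w /= /andP[zw wy]; rewrite /D/= wy (le_trans xz zw).
  rewrite !fsbig_finite ?mulr_sumr; [|exact: finite_interval..].
  by apply: eq_bigr => w _; rewrite mulrA.
rewrite exchange_fsbig; [|exact: finite_interval..].
apply: eq_fsbigr => w; rewrite inE => /andP[xw wy].
rewrite [in RHS](fsbig_widen _ D); first last.
- move=> z [/andP[xz zy] /= nzw]; rewrite /preimage/= (@inc_supp _ _ _ g) ?mulr0//.
  by apply/negP => zw; apply: nzw; rewrite xz.
- by move=> z /= /andP[xz zw]; rewrite /D/= xz (le_trans zw wy).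
by rewrite !fsbig_finite ?mulr_suml; [|exact: finite_interval..].
Qed.

Fact inc_mul1l : left_id inc_one inc_mul.
Proof.
move=> f; apply: incP => x y /=.
have [xy|xy] := boolP (x <= y)%O; last first.
  by rewrite (inc_mul_supp inc_one f xy) inc_supp.
rewrite (fsbigD1 x) ?eqxx ?mul1r/= ?lexx//; last exact: finite_interval.
by rewrite fsbig1 ?addr0// => z [_ /= /eqP]; rewrite eq_sym => /negbTE->; rewrite mul0r.
Qed.

Fact inc_mul1r : right_id inc_one inc_mul.
Proof.
move=> f; apply: incP => x y /=.
have [xy|xy] := boolP (x <= y)%O; last first.
  by rewrite (inc_mul_supp f inc_one xy) inc_supp.
rewrite (fsbigD1 y) ?eqxx ?mulr1/= ?lexx ?xy//; last exact: finite_interval.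
by rewrite fsbig1 ?addr0// => z [_ /= /eqP/negbTE->]; rewrite mulr0.
Qed.

Fact inc_mulDl : left_distributive inc_mul +%R.
Proof.
move=> f g h; apply: incP => x y /=; rewrite -fsbig_split; last exact: finite_interval.
by apply: eq_fsbigr => z _; rewrite mulrDl.
Qed.

Fact inc_mulDr : right_distributive inc_mul +%R.
Proof.
move=> f g h; apply: incP => x y /=; rewrite -fsbig_split; last exact: finite_interval.
by apply: eq_fsbigr => z _; rewrite mulrDr.
Qed.

HB.instance Definition _ := GRing.Zmodule_isPzRing.Build I
  inc_mulA inc_mul1l inc_mul1r inc_mulDl inc_mulDr.

End IncidenceRing.

(* The elements of the incidence ring all of whose values lie in [J]. *)
Definition inc_set d (X : locFinPOrderType d) (R : pzRingType) (J : set R) :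
  set (incidence X R) := [set f : incidence X R | forall x y, J (f x y)].
Arguments inc_set {d} X {R} J.

(* Main.v *)
(** An ideal is essential iff every nonzero [r] has a nonzero left multiple in
    it.  If [ann_l f] is essential, test it on [r e_(m,x)] with [m] minimal below
    [x]: since [m] is minimal, a nonzero multiple [a r e_(m,x)] killed by [f] has
    [a(m,m) r <> 0], and [a(m,m) r f(x,y) = 0].  Conversely, every element lies
    above a minimal one, so all principal up-sets are finite; thus a nonzero row
    [g(p,_)] can be multiplied by finitely many scalars, one for each pair of
    elements above [p], so as to be killed by [f] while staying nonzero. *)
Require Import Defs.
From mathcomp Require Import all_boot all_order all_algebra.
From mathcomp Require Import boolp classical_sets cardinality fsbigop.

Set Implicit Arguments.
Unset Strict Implicit.
Unset Printing Implicit Defensive.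

Import Order.TTheory GRing.Theory.

Local Open Scope classical_set_scope.
Local Open Scope ring_scope.

Section Rings.
Variable A : pzRingType.
Implicit Types (I : set A) (a r : A).

(** Every nonzero left ideal contains a nonzero principal one, so intersections need only be tested
    against the ideals [A r]. *)
Lemma left_essentialP I : left_ideal I ->
  left_essential I <-> forall r, r <> 0 -> exists2 s, s * r <> 0 & I (s * r).
Proof.
move=> idI; split=> [[_ essI] r r0 | essI].
- pose J : set A := [set s * r | s in setT].
  have idJ : left_ideal J.
    split; first by exists 0; rewrite ?mul0r.
      by move=> _ _ [s _ <-] [t _ <-]; exists (s - t); rewrite ?mulrBl.
    by move=> a _ [s _ <-]; exists (a * s); rewrite ?mulrA.
  have J0 : J <> [set 0].
    by move=> J0; apply: r0; rewrite -[_ = 0]/([set 0] r) -J0; exists 1; rewrite ?mul1r.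
  apply: contrapT => noS; apply: (essI J idJ J0).
  apply/seteqP; split=> [u [Iu [s _ su]] | _ ->].
    by apply: contrapT => u0; apply: noS; exists s; rewrite su.
  by split; [case: idI | case: idJ].
- split=> // J [J0 _ Jmul] JN0 IJ0; apply: JN0.
  apply/seteqP; split=> [r Jr | _ -> //].
  apply: contrapT => r0; have [s s0 Is] := essI r r0.
  by apply: s0; rewrite -[_ = 0]/([set 0] (s * r)) -IJ0; split=> //; exact: Jmul.
Qed.

Lemma ann_l_ideal a : left_ideal (ann_l a).
Proof.
split; first exact: mul0r.
- by rewrite /ann_l => u v /= ua va; rewrite mulrBl ua va subrr.
- by rewrite /ann_l => b u /= ua; rewrite -mulrA ua mulr0.
Qed.

Lemma Sing_lP a :
  Sing_l A a <-> forall r, r <> 0 -> exists2 s, s * r <> 0 & s * r * a = 0.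
Proof. exact: (left_essentialP (ann_l_ideal a)). Qed.

(** Induction on [l]: new scalars multiply on the left, so products already killed stay killed. The
    index of the surviving entry of the row may change at each step. *)
Lemma Sing_l_kill_row (T : eqType) (c : T -> A) (f : T -> T -> A)
    (l : seq (T * T)) :
  (forall x y, Sing_l A (f x y)) -> (exists x, c x <> 0) ->
  exists2 s, exists x, s * c x <> 0
    & forall x y, (x, y) \in l -> s * c x * f x y = 0.
Proof.
move=> singf c0; elim: l => [|[x y] l [s [z sz0] skill]].
  by exists 1 => //; case: c0 => x cx; exists x; rewrite mul1r.
have [sx0|sx0] := pselect (s * c x = 0).
  exists s => [|u v]; first by exists z.
  by rewrite inE => /predU1P[[-> ->]|/skill//]; rewrite sx0 mul0r.
(* Here [s * c x] is nonzero, so singularity of [f x y] supplies [t]; the entry at [x] replaces the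
   one at [z] as the surviving entry. *)
have /Sing_lP/(_ _ sx0)[t tx0 txf] := singf x y.
exists (t * s) => [|u v]; first by exists x; rewrite -mulrA.
rewrite inE => /predU1P[[-> ->]|/skill suv]; first by rewrite -(mulrA t).
by rewrite -!mulrA (mulrA s) suv mulr0.
Qed.

End Rings.

Section Posets.
Context {d : Order.disp_t} (X : porderType d).

(** With no minimal element below it, [x] would be incomparable to all of them; adjoining it to
    [Min X] and using maximality would make [x] itself minimal. *)
Lemma Min_maximal_antichain_le (x : X) :
  maximal_antichain (Min X) -> exists2 m, Min X m & (m <= x)%O.
Proof.
move=> [antiM maxM]; apply: contrapT => nom.
have incx m : Min X m -> (m >< x)%O.
  move=> mM; rewrite /Order.comparable negb_or; apply/andP; split; apply/negP.
    by move=> mx; apply: nom; exists m.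
  by move=> xm; apply: nom; exists m; rewrite // (mM x xm).
have Mx : Min X x.
  rewrite -(maxM (x |` Min X)); [by left| |by move=> y; right].
  move=> u v [->|uM] [->|vM] // uv.
  - by rewrite comparable_sym incx.
  - exact: incx.
  - exact: antiM.
by apply: nom; exists x.
Qed.

End Posets.

Section MatrixUnits.
Context {d : Order.disp_t} (X : locFinPOrderType d) (R : pzRingType).
Implicit Types (f : incidence X R) (x y u v : X) (r : R).

Fact inc_unit_supp x y r u v : ~~ (u <= v)%O ->
  (if [&& u == x, v == y & (x <= y)%O] then r else 0) = 0.
Proof. by case: and3P => // -[/eqP-> /eqP-> ->]. Qed.

(* [r e_(x,y)], or [0] when [x <= y] fails. *)
Definition inc_unit x y r : incidence X R := Incidence (inc_unit_supp x y r).

Lemma inc_mulE f g x y :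
  (f * g) x y = \sum_(z \in [set z : X | (x <= z <= y)%O]) f x z * g z y.
Proof. by []. Qed.

Lemma inc_unit_mul x y r f u v : (x <= y)%O ->
  (inc_unit x y r * f) u v = if u == x then r * f y v else 0.
Proof.
move=> xy; have [uv|uv] := boolP (u <= v)%O; last first.
  rewrite inc_supp//; case: eqP => // ux; rewrite inc_supp ?mulr0//.
  by apply: contra uv => yv; rewrite ux (le_trans xy yv).
rewrite inc_mulE; case: eqVneq => [->|/negbTE ux]; last first.
  by apply: fsbig1 => z _ /=; rewrite ux mul0r.
have [yv|yv] := boolP (y <= v)%O; last first.
  rewrite (inc_supp f yv) mulr0; apply: fsbig1 => z /= /andP[_ zv].
  by case: and3P => [[_ /eqP zy _]|_]; [rewrite -zy zv in yv | rewrite mul0r].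
rewrite (fsbigD1 y) /= ?eqxx ?xy ?yv//; last exact: finite_interval.
rewrite fsbig1 ?addr0// => z [_ /= /eqP/negbTE ->].
by rewrite mul0r.
Qed.

Lemma mul_inc_unit x y r f u v : (x <= y)%O ->
  (f * inc_unit x y r) u v = if v == y then f u x * r else 0.
Proof.
move=> xy; have [uv|uv] := boolP (u <= v)%O; last first.
  rewrite inc_supp//; case: eqP => // vy; rewrite inc_supp ?mul0r//.
  by apply: contra uv => ux; rewrite vy (le_trans ux xy).
rewrite inc_mulE; case: eqVneq => [->|/negbTE vy]; last first.
  by apply: fsbig1 => z _ /=; rewrite vy andbF mulr0.
have [ux|ux] := boolP (u <= x)%O; last first.
  rewrite (inc_supp f ux) mul0r; apply: fsbig1 => z /= /andP[uz _].
  by case: and3P => [[/eqP zx _ _]|_]; [rewrite -zx uz in ux | rewrite mulr0].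
rewrite (fsbigD1 x) /= ?eqxx ?xy ?ux//; last exact: finite_interval.
by rewrite fsbig1 ?addr0// => z [_ /= /eqP/negbTE ->]; rewrite mulr0.
Qed.

Lemma inc_neq0 f : f <> 0 -> exists x y, f x y <> 0.
Proof.
move=> f0; apply: contrapT => nof; apply: f0; apply: incP => x y.
by apply: contrapT => fxy; apply: nof; exists x, y.
Qed.

Lemma Sing_l_incidence_sub (f : incidence X R) x y :
  (exists2 m, Min X m & (m <= x)%O) ->
  Sing_l (incidence X R) f -> Sing_l R (f x y).
Proof.
move=> [m mM mx] /Sing_lP singf; apply/Sing_lP => r r0.
have e0 : inc_unit m x r <> 0.
  by move=> /(congr1 (fun h : incidence X R => h m x)) /=; rewrite !eqxx mx.
(* Only column [x] of [a * inc_unit m x r] can be nonzero, with entries [a u m * r]; minimality of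
   [m] leaves just [u = m]. *)
have [a ae0 aef0] := singf _ e0; exists (a m m).
  have [u [v]] := inc_neq0 ae0; rewrite mul_inc_unit//; case: eqP => // _.
  have [um|um] := boolP (u <= m)%O; first by rewrite (mM u um).
  by rewrite (inc_supp a um) mul0r.
(* Left multiplication by the idempotent at [(m, m)] extracts row [m], which turns [aef0] into the
   vanishing of [a m m * r * f x y]. *)
have rowE : inc_unit m x (a m m * r) = inc_unit m m 1 * (a * inc_unit m x r).
  apply: incP => u v; rewrite inc_unit_mul// mul_inc_unit// mul1r /= mx andbT.
  by case: (u == m).
have := inc_unit_mul (a m m * r) f m y mx.
by rewrite eqxx => <-; rewrite rowE -!mulrA (mulrA a) aef0 mulr0.
Qed.

Lemma inc_set_Sing_l_sub (f : incidence X R) :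
  (forall x, finite_set [set y : X | (x <= y)%O]) ->
  inc_set X (Sing_l R) f -> Sing_l (incidence X R) f.
Proof.
move=> finX singf; apply/Sing_lP => g /inc_neq0[p [q gpq]].
have /finite_seqP[l upE] := finX p.
have gp0 : exists v, g p v <> 0 by exists q.
(* Every product [g p z * f z w] with [p <= z <= w] involves a pair from the finite up-set of [p],
   so one scalar [s] handles them all. *)
have [s [v sgv] skill] :=
  Sing_l_kill_row [seq (u, w) | u <- l, w <- l] singf gp0.
(* This multiplier keeps only row [p] of [g], scaled by [s]; the other rows need no treatment. *)
exists (inc_unit p p s).
  move=> /(congr1 (fun h : incidence X R => h p v)).
  by rewrite inc_unit_mul// eqxx.
apply: incP => u w; rewrite -mulrA inc_unit_mul//; case: eqP => // _.
have inl z : (p <= z)%O -> z \in l.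
  by move=> pz; have : [set y : X | (p <= y)%O] z by []; rewrite upE.
(* The sum vanishes term by term, without any cancellation. *)
rewrite inc_mulE fsbig_finite ?mulr_sumr; last exact: finite_interval.
apply: big1_seq => z /=; rewrite in_fset_set ?inE; last exact: finite_interval.
move=> /andP[pz zw]; rewrite mulrA skill//.
by apply: allpairs_f; apply: inl; rewrite // (le_trans pz).
Qed.

End MatrixUnits.

Theorem proposition2p0p7 (d : Order.disp_t) (X : locFinPOrderType d)
  (R : pzRingType)
  (hMin : maximal_antichain (Min X))
  (hkappa : forall x : X, Min X x -> finite_set [set y : X | (x <= y)%O]) :
  Sing_l (incidence X R) = inc_set X (Sing_l R).
Proof.
apply/seteqP; split=> f singf.
  by move=> x y; apply: Sing_l_incidence_sub => //; exact: Min_maximal_antichain_le.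
apply: inc_set_Sing_l_sub => // x.
have [m /hkappa finm mx] := Min_maximal_antichain_le x hMin.
by apply: sub_finite_set finm => y /=; exact: le_trans.
Qed.
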